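(* Let $(\mathcal R,X,\mathcal N)$ be a digit system with $\mathcal R=\mathcal E[x]/(P)$, let $k\ge\deg P$ be minimal such that every digit in $\mathcal N$ can be represented by a polynomial in $\mathcal E[x]$ of degree at most $k$, let $\mathcal R_k$ be the $\mathcal E$-submodule of $\mathcal R$ generated by $1,X,\dots,X^{k-1}$, and let $\mathcal V$ be a set of witnesses of $\mathcal R_k$. Then $(\mathcal R,X,\mathcal N)$ has the finite expansion property if and only if every element of $\mathcal V$ has a finite $X$-ary expansion.
   Context: Let $\mathcal E$ be a commutative ring with identity, $d\ge1$, $P(x)=p_dx^d+\dots+p_0\in\mathcal E[x]$ with $p_d,p_0$ not zero divisors of $\mathcal E$ and $\mathcal E/(p_0)$ finite, $\mathcal R=\mathcal E[x]/(P)$, $X$ the image of $x$, and $\mathcal N\subset\mathcal R$ a system of coset representatives of $\mathcal R/(X)$; $(\mathcal R,X,\mathcal N)$ is a digit system. $D_{\mathcal N}(A)$ is the unique $e\in\mathcal N$ with $A\equiv e\pmod X$ and $T(A)=\frac{A-D_{\mathcal N}(A)}{X}$ (the unique $B$ with $XB=A-D_{\mathcal N}(A)$). $A$ has a finite $X$-ary expansion if $T^n(A)=0$ for some $n\in\mathbb N$; the finite expansion property means every $A\in\mathcal R$ has one. A set of witnesses of a subset $\mathcal S\subseteq\mathcal R$ is a set $\mathcal V\subset\mathcal S$ such that (i) every $A\in\mathcal S$ is a finite sum of elements of $\mathcal V$, and (ii) for each $e\in\mathcal N$ and each $v\in\mathcal V$, $T(v+e)\in\mathcal V$. *)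

(* Defs.v *)
From HB Require Import structures.
From mathcomp Require Import all_boot all_order all_algebra.
From mathcomp Require Import generic_quotient ring_quotient.
From mathcomp Require Import boolp classical_sets cardinality.

Set Implicit Arguments.
Unset Strict Implicit.
Unset Printing Implicit Defensive.

Import GRing.Theory.
Local Open Scope ring_scope.
Local Open Scope quotient_scope.
Local Open Scope classical_set_scope.

Section PrincipalIdeal.
Variables (A : comNzRingType) (a : A).

Definition princ_ideal : {pred A} := fun x => `[< exists y, x = y * a >].

Lemma princ_idealP x : reflect (exists y, x = y * a) (x \in princ_ideal).
Proof. exact: asboolP. Qed.

Fact princ_ideal_zmod_closed : zmod_closed princ_ideal.
Proof.
split=> [|x y /princ_idealP[u ->] /princ_idealP[v ->]]; apply/princ_idealP.
  by exists 0; rewrite mul0r.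
by exists (u - v); rewrite mulrBl.
Qed.

HB.instance Definition _ :=
  GRing.isZmodClosed.Build A princ_ideal princ_ideal_zmod_closed.

End PrincipalIdeal.

(* The polynomials P to which digit systems are attached. [GRing.lreg] is
   injectivity of multiplication, i.e. not being a zero divisor (0 counts as
   one). The ideal (p_0) may be all of E, so that {ideal_quot _} is used below
   only as an additive group. *)
Record digitPoly (E : comNzRingType) := DigitPoly {
  dpoly :> {poly E};
  dpoly_deg : (1 <= (size dpoly).-1)%N;
  dpoly_lead : GRing.lreg (lead_coef dpoly);
  dpoly_const : GRing.lreg dpoly`_0;
  dpoly_finite : finite_set [set: {ideal_quot (princ_ideal dpoly`_0)}]
}.

Section DigitSystem.
Variables (E : comNzRingType) (P : digitPoly E).

(* The ring structure of {ideal_quot _} requires the ideal to be proper, which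
   holds for (P) because deg P >= 1 and p_d is not a zero divisor. *)
Definition dpoly_ideal : {pred {poly E}} := princ_ideal (dpoly P).

Fact dpoly_ideal_closed : idealr_closed dpoly_ideal.
Proof.
have [z0 zB] := princ_ideal_zmod_closed (dpoly P).
split=> // [|q x y /princ_idealP[u ->] /princ_idealP[v ->]]; last first.
  by apply/princ_idealP; exists (q * u + v); rewrite mulrDl mulrA.
apply/negP => /princ_idealP[q]; rewrite mulrC.
have [-> /eqP|qN0] := eqVneq q 0; first by rewrite mulr0 oner_eq0.
move=> /(congr1 (@size _ : {poly E} -> _)).
rewrite size_poly1 size_proper_mul; last first.
  by rewrite mulrI_eq0 ?lead_coef_eq0 //; exact: dpoly_lead.
have := dpoly_deg P; rewrite -size_poly_gt0 in qN0.
case: (size (dpoly P)) => [|[|m]] //= _.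
by case: (size q) qN0 => // n _; rewrite addnS.
Qed.

HB.instance Definition _ :=
  isIdealr.Build {poly E} dpoly_ideal dpoly_ideal_closed.

Definition qring : comNzRingType := {ideal_quot dpoly_ideal}.

Definition qpi (Q : {poly E}) : qring := \pi_{ideal_quot dpoly_ideal} Q.

Definition qX : qring := qpi 'X.

Definition coset_reps (N : set qring) : Prop :=
  forall A, exists! e, N e /\ A - e \in princ_ideal qX.

(* The values of [digit] and [shift] are meaningful when [coset_reps N] holds:
   see [digitP], [digit_unique], [shiftP] and [shift_unique]. *)
Definition digit (N : set qring) (A : qring) : qring :=
  xget 0 [set e | N e /\ A - e \in princ_ideal qX].

Definition shift (N : set qring) (A : qring) : qring :=
  xget 0 [set B | qX * B = A - digit N A].

Definition finite_expansion (N : set qring) (A : qring) : Prop :=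
  exists n : nat, iter n (shift N) A = 0.

Definition finite_expansion_property (N : set qring) : Prop :=
  forall A, finite_expansion N A.

Definition digits_of_degree (N : set qring) (k : nat) : Prop :=
  forall e, N e -> exists2 Q : {poly E}, (size Q <= k.+1)%N & qpi Q = e.

Definition minimal_degree (N : set qring) (k : nat) : Prop :=
  [/\ ((size (dpoly P)).-1 <= k)%N, digits_of_degree N k &
      forall j, ((size (dpoly P)).-1 <= j)%N -> digits_of_degree N j -> (k <= j)%N].

(* c in E acts on [qring] as multiplication by the class of c%:P. *)
Definition qspan (k : nat) : set qring :=
  [set A | exists c : 'I_k -> E, A = \sum_(i < k) qpi (c i)%:P * qX ^+ i].

Definition witnesses (N S V : set qring) : Prop :=
  [/\ V `<=` S,
      forall A, S A -> exists2 s : seq qring,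
        (forall v, v \in s -> V v) & A = \sum_(v <- s) v &
      forall e v, N e -> V v -> V (shift N (v + e))].

Lemma qpiM Q S : qpi (Q * S) = qpi Q * qpi S.
Proof. exact: (rmorphM (\pi_{ideal_quot dpoly_ideal})). Qed.

Lemma qpi_eq0 Q : qpi Q = 0 <-> exists S, Q = S * dpoly P.
Proof.
have -> : (0 : qring) = qpi 0 by rewrite /qpi raddf0.
split=> [/eqP|[S QE]].
  by rewrite /qpi -Quotient.idealrBE subr0 => /princ_idealP.
apply/eqP; rewrite /qpi -Quotient.idealrBE subr0; apply/princ_idealP.
by exists S.
Qed.

Lemma qX_lreg : GRing.lreg qX.
Proof.
suff X0 A : qX * A = 0 -> A = 0.
  by move=> A B AB; apply/subr0_eq/X0; rewrite mulrBr AB subrr.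
have [Q ->] : exists Q, A = qpi Q.
  by exists (repr A); rewrite /qpi reprK.
rewrite -qpiM => /qpi_eq0[S QS]; apply/qpi_eq0.
have S0 : S`_0 = 0.
  apply: (@dpoly_const _ P); rewrite mulr0 mulrC.
  by have := congr1 (fun p : {poly E} => p`_0) QS; rewrite coefXM /= coef0M.
pose S' : {poly E} := \poly_(i < size S) S`_i.+1; exists S'.
have SE : S = 'X * S'.
  apply/polyP=> -[|i]; rewrite coefXM //= coef_poly.
  by case: ltnP => // szS; rewrite nth_default // leqW.
apply/polyP=> i; move: QS; rewrite SE -mulrA.
by move=> /(congr1 (fun p : {poly E} => p`_i.+1)); rewrite !coefXM.
Qed.

Section WellDefined.
Variable N : set qring.
Hypothesis repsN : coset_reps N.

Lemma digitP A : N (digit N A) /\ A - digit N A \in princ_ideal qX.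
Proof.
rewrite /digit; case: xgetP => [e _ //|noe].
by have [e [eP _]] := repsN A; case: (noe e).
Qed.

Lemma digit_unique A e : N e -> A - e \in princ_ideal qX -> digit N A = e.
Proof.
move=> Ne Ae; have [f [_ fu]] := repsN A.
by rewrite -(fu _ (digitP A)); exact: fu.
Qed.

Lemma shiftP A : qX * shift N A = A - digit N A.
Proof.
rewrite /shift; case: xgetP => [B _ //|noB].
have [_ /princ_idealP[B AB]] := digitP A.
by case: (noB B); rewrite /= AB mulrC.
Qed.

Lemma shift_unique A B : qX * B = A - digit N A -> shift N A = B.
Proof. by move=> AB; apply: qX_lreg; rewrite shiftP. Qed.

End WellDefined.

End DigitSystem.

Arguments qspan {E} P k.

(* Main.v *)
Require Import Defs.
From mathcomp Require Import all_boot all_order all_algebra.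
From mathcomp Require Import boolp classical_sets.
From mathcomp Require Import generic_quotient ring_quotient.

(** Adding a witness [v] to [A] perturbs every iterate [T^n(A)] only by another
    witness, because [T(A + v) = T(A) + T(v + D(A))]. Hence, when all witnesses
    have finite expansions, the elements with a finite expansion are closed under
    adding witnesses, so all of [R_k] has finite expansions. On the other hand
    [T] lowers the degree of a representing polynomial as long as it is at least
    [k], so every orbit of [T] enters [R_k]. *)

Import GRing.Theory.
Local Open Scope ring_scope.
Local Open Scope quotient_scope.
Local Open Scope classical_set_scope.

Section DigitSystemTheory.
Set Implicit Arguments.
Unset Strict Implicit.
Variables (E : comNzRingType) (P : digitPoly E).
Implicit Types (A B v : qring P) (Q S : {poly E}) (N V : set (qring P)).

Lemma qpiB Q S : qpi P (Q - S) = qpi P Q - qpi P S.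
Proof. exact: (raddfB (\pi_{ideal_quot (dpoly_ideal P)})). Qed.

Lemma qpi_sum (I : Type) (r : seq I) (F : I -> {poly E}) :
  qpi P (\sum_(i <- r) F i) = \sum_(i <- r) qpi P (F i).
Proof. exact: (raddf_sum (\pi_{ideal_quot (dpoly_ideal P)})). Qed.

Lemma qpiXn n : qpi P ('X^n) = qX P ^+ n.
Proof. exact: (rmorphXn (\pi_{ideal_quot (dpoly_ideal P)})). Qed.

Lemma qpi_surj A : exists Q, qpi P Q = A.
Proof. by exists (repr A); rewrite /qpi reprK. Qed.

Lemma qpi_eq Q S : qpi P Q = qpi P S <-> exists U, Q - S = U * dpoly P.
Proof.
rewrite -qpi_eq0 qpiB; split=> [->|/subr0_eq //].
by rewrite subrr.
Qed.

Lemma qspan_qpi k Q : (size Q <= k)%N -> qspan P k (qpi P Q).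
Proof.
move=> szQ; exists (fun i => Q`_i).
have {1}-> : Q = \sum_(i < k) (Q`_i)%:P * 'X^i.
  rewrite -[LHS](@poly_take_drop _ k) [drop_poly k Q]drop_poly_eq0 // mul0r addr0.
  rewrite /take_poly poly_def; apply: eq_bigr => i _.
  by rewrite mul_polyC.
by rewrite qpi_sum; apply: eq_bigr => i _; rewrite qpiM qpiXn.
Qed.

Section CosetReps.
Variable N : set (qring P).
Hypothesis repsN : coset_reps N.

(** Since [A - digit N A] is a multiple of [qX], the elements [A + v] and [v + digit N A] have the
    same digit; subtract it and cancel [qX]. *)
Lemma shiftD A v : shift N (A + v) = shift N A + shift N (v + digit N A).
Proof.
have [Ne _] := digitP repsN (v + digit N A).
have sumE : A + v - digit N (v + digit N A) =
    qX P * (shift N A + shift N (v + digit N A)).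
  rewrite mulrDr !(shiftP repsN); set d := digit N (v + _).
  by rewrite [RHS]addrA [v + _]addrC [in RHS]addrA subrK.
have digitE : digit N (A + v) = digit N (v + digit N A).
  apply: (digit_unique repsN) => //; rewrite sumE.
  by apply/princ_idealP; eexists; rewrite mulrC.
by apply: (shift_unique repsN); rewrite digitE sumE.
Qed.

Lemma iter_shiftD V A v n :
    (forall e v, N e -> V v -> V (shift N (v + e))) -> V v ->
  exists2 w, V w & iter n (shift N) (A + v) = iter n (shift N) A + w.
Proof.
move=> Vshift Vv; elim: n => [|n [w Vw IHn]]; first by exists v.
(* The perturbation evolves by adding the current digit of the unperturbed orbit and shifting, which
   keeps it in [V]. *)
exists (shift N (w + digit N (iter n (shift N) A))); last first.
  by rewrite iterS IHn shiftD.
by apply: Vshift => //; have [] := digitP repsN (iter n (shift N) A).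
Qed.

Lemma finite_expansion_iter n A :
  finite_expansion N (iter n (shift N) A) -> finite_expansion N A.
Proof. by move=> [m]; rewrite -iterD; exists (m + n)%N. Qed.

(** By induction on [s]: after the steps that bring the sum of the tail to 0, what is left of the
    whole sum is a single witness. *)
Lemma finite_expansion_sum V (s : seq (qring P)) :
    (forall e v, N e -> V v -> V (shift N (v + e))) ->
    (forall v, V v -> finite_expansion N v) -> (forall v, v \in s -> V v) ->
  finite_expansion N (\sum_(v <- s) v).
Proof.
move=> Vshift Vfin; elim: s => [|v s IHs] sV; first by exists 0%N; rewrite big_nil.
have [n sumn0] : finite_expansion N (\sum_(w <- s) w).
  by apply: IHs => w ws; apply: sV; rewrite inE ws orbT.
have [w Vw iterE] := iter_shiftD (\sum_(w <- s) w) n Vshift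
  (sV v (mem_head v s)).
apply: (finite_expansion_iter (n := n)).
by rewrite big_cons addrC iterE sumn0 add0r; exact: Vfin.
Qed.

(* The representative of [A - D(A)] is corrected by a constant multiple of [P]
   so that its constant term vanishes and it can be divided by ['X]. *)
Lemma shift_qpi k m Q :
    ((size (dpoly P)).-1 <= k)%N -> digits_of_degree N k -> (k <= m)%N ->
    (size Q <= m.+1)%N ->
  exists2 S : {poly E}, (size S <= m)%N & shift N (qpi P Q) = qpi P S.
Proof.
move=> degPk Ndeg km szQ.
have [/Ndeg[D szD DE] _] := digitP repsN (qpi P Q).
have [B BE] := qpi_surj (shift N (qpi P Q)).
have : qpi P (Q - D) = qpi P ('X * B).
  by rewrite qpiB qpiM DE BE (shiftP repsN).
move=> /qpi_eq[U UE].
pose W : {poly E} := Q - D - U`_0 *: dpoly P.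
(* As [m] is at least the degree of [P], the correction keeps the degree at most [m]. *)
have szP : (size (dpoly P) <= m.+1)%N.
  by apply: leq_trans (leqSpred _) _; rewrite ltnS (leq_trans degPk).
have szW : (size W <= m.+1)%N.
  have szD' : (size D <= m.+1)%N by apply: leq_trans szD _; rewrite ltnS.
  apply: leq_trans (size_polyD _ _) _; rewrite geq_max size_polyN.
  rewrite (leq_trans (size_scale_leq _ _) szP) andbT.
  by apply: leq_trans (size_polyD _ _) _; rewrite geq_max size_polyN szQ.
have W0 : W`_0 = 0.
  (* ['X * B] has no constant term, so [Q - D] and [U * dpoly P] have the same one. *)
  have := congr1 (fun p : {poly E} => p`_0) UE.
  rewrite coefB coefXM /= subr0 coef0M => QD0.
  by rewrite /W coefB QD0 coefZ subrr.
pose Q' : {poly E} := \poly_(i < m) W`_i.+1.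
have WE : W = 'X * Q'.
  apply/polyP=> -[|i]; rewrite coefXM //= coef_poly.
  by case: ltnP => // mi; rewrite nth_default // (leq_trans szW).
exists Q'; first exact: size_poly.
apply: (shift_unique repsN); rewrite -DE -qpiM -qpiB -WE; apply/qpi_eq.
exists (- (U`_0)%:P).
by rewrite /W [_ - _ *: _]addrC addrK mulNr mul_polyC.
Qed.

Lemma iter_shift_qspan k A :
    ((size (dpoly P)).-1 <= k)%N -> digits_of_degree N k ->
  exists n, qspan P k (iter n (shift N) A).
Proof.
move=> degPk Ndeg; have [Q <-] := qpi_surj A.
(* Induction on a bound [j] for the excess of the size over [k], initially [size Q]; each shift
   lowers it by one. *)
have := leq_addl k (size Q); move: {2}(size Q) => j; elim: j Q => [|j IHj] Q szQ.
  by exists 0%N; apply: qspan_qpi; rewrite -[k]addn0.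
rewrite addnS in szQ.
have [Q' szQ' QE] := shift_qpi degPk Ndeg (leq_addr j k) szQ.
have [n nP] := IHj Q' szQ'.
by exists n.+1; rewrite iterSr QE.
Qed.

End CosetReps.

End DigitSystemTheory.

Theorem theorem6p4 (E : comNzRingType) (P : digitPoly E) (N : set (qring P))
    (repsN : coset_reps N) (k : nat) (kmin : minimal_degree N k)
    (V : set (qring P)) (witV : witnesses N (qspan P k) V) :
  finite_expansion_property N <-> (forall v : qring P, V v -> finite_expansion N v).
Proof.
split=> [finN v _|Vfin A]; first exact: finN.
have [degPk Ndeg _] := kmin; have [_ Vgen Vshift] := witV.
have [n /Vgen[s sV sE]] := iter_shift_qspan repsN A degPk Ndeg.
apply: (finite_expansion_iter (n := n)); rewrite sE.
exact: (finite_expansion_sum repsN Vshift).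
Qed.
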